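(* Let $Y$ be the semimartingale defined in the context. As $t\to\infty$, $Y_t\to\infty$ almost surely.
   Context: $(\Omega,\mathcal{F},\mathbb{P})$ is a probability space with a filtration $(\mathcal{F}_t)_{t\geq 0}$ which generates $\mathcal{F}$ and satisfies the usual conditions (right continuous, $\mathcal{F}_0$ contains all $\mathbb{P}$-null sets). Semimartingales have càdlàg paths; quadratic variations and stochastic integrals have value $0$ at time $0$. A martingale $M$ is normal if $t \mapsto (M_t-M_0)^2 - t$ is also a martingale. $X$ is the (unique in law) normal martingale with $X_0 = 0$ and $\mathrm{d}[X]_t = (1 - t - X_{t-})\,\mathrm{d}X_t + \mathrm{d}t$, i.e. $[X]_t = \int_0^t (1-s-X_{s-})\,\mathrm{d}X_s + t$ for all $t\ge 0$; and $Y_t := X_t + t$ for all $t \geq 0$. *)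

(* Defs.v *)
From HB Require Import structures.
From mathcomp Require Export all_boot all_order all_algebra.
From mathcomp Require Export all_classical all_reals all_analysis.

Set Implicit Arguments.
Unset Strict Implicit.
Unset Printing Implicit Defensive.

Import Order.TTheory GRing.Theory Num.Theory.
Import numFieldNormedType.Exports.

Local Open Scope classical_set_scope.
Local Open Scope ring_scope.

(* Time is the half-line [0, +oo[ inside R: a process is a function
   [R -> T -> R] (time first), whose values at negative times are never used. *)

Section Filtrations.
Context (R : realType) (d : measure_display) (T : measurableType d).

Definition is_filtration (F : R -> set (set T)) : Prop :=
  (forall t, 0 <= t -> sigma_algebra setT (F t) /\ F t `<=` measurable) /\
  (forall s t, 0 <= s -> s <= t -> F s `<=` F t).

Definition generates (F : R -> set (set T)) : Prop :=
  (measurable : set (set T)) = <<s \bigcup_(t in [set t : R | 0 <= t]) F t >>.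

Definition usual_conditions (P : probability T R) (F : R -> set (set T)) :
    Prop :=
  (forall t, 0 <= t -> F t = \bigcap_(s in [set s : R | t < s]) F s) /\
  (forall A, measurable A -> P A = 0%E -> F 0 A).

Definition measurable_wrt (G : set (set T)) (Z : T -> R) : Prop :=
  forall B : set R, measurable B -> G (Z @^-1` B).

Definition adapted (F : R -> set (set T)) (X : R -> T -> R) : Prop :=
  forall t, 0 <= t -> measurable_wrt (F t) (X t).

Definition stopping_time (F : R -> set (set T)) (tau : T -> R) : Prop :=
  (forall w, 0 <= tau w) /\
  (forall t, 0 <= t -> F t [set w | tau w <= t]).

Definition stopped_sigma (F : R -> set (set T)) (tau : T -> R) : set (set T) :=
  [set A | measurable A /\
           forall t, 0 <= t -> F t (A `&` [set w | tau w <= t])].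

Definition cadlag (X : R -> T -> R) : Prop :=
  forall w t,
    (0 <= t -> X s w @[s --> t^'+] --> X t w) /\
    (0 < t -> cvg (X s w @[s --> t^'-])).

Definition caglad (X : R -> T -> R) : Prop :=
  forall w t,
    (0 < t -> X s w @[s --> t^'-] --> X t w) /\
    (0 <= t -> cvg (X s w @[s --> t^'+])).

(* The process X_{t-}, with X_{0-} := X_0; stochastic integrals below are over
   ]0, t], so the value at time 0 is immaterial. *)
Definition left_limit (X : R -> T -> R) (t : R) (w : T) : R :=
  if 0 < t then lim (X s w @[s --> t^'-]) else X 0 w.

End Filtrations.

Section Martingales.
Context (R : realType) (d : measure_display) (T : measurableType d)
  (P : probability T R).

(* V is a version of the conditional expectation of Z given G. *)
Definition is_cond_expectation (G : set (set T)) (Z V : T -> R) : Prop :=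
  [/\ measurable_wrt G V,
      P.-integrable setT (EFin \o V) &
      forall A, G A ->
        (\int[P]_(w in A) (V w)%:E = \int[P]_(w in A) (Z w)%:E)%E].

Definition martingale (F : R -> set (set T)) (M : R -> T -> R) : Prop :=
  [/\ adapted F M,
      cadlag M,
      forall t, 0 <= t -> P.-integrable setT (EFin \o M t) &
      forall s t, 0 <= s -> s <= t -> is_cond_expectation (F s) (M t) (M s)].

Definition normal_martingale (F : R -> set (set T)) (M : R -> T -> R) : Prop :=
  martingale F M /\ martingale F (fun t w => (M t w - M 0 w) ^+ 2 - t).

End Martingales.

(* Stochastic integration of adapted caglad integrands, following Protter:
   the elementary integral of simple predictable processes, extended by
   continuity for uniform convergence on compacts in probability (ucp). *)
Section StochasticIntegral.
Context (R : realType) (d : measure_display) (T : measurableType d)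
  (P : probability T R) (F : R -> set (set T)).

(* The process h_0 1_{0} + \sum_(i < n) h_i 1_{]tau_i, tau_(i+1)]}. *)
Record simple_predictable := SimplePredictable {
  sp_size : nat;
  sp_time : nat -> T -> R;
  sp_init : T -> R;
  sp_coef : nat -> T -> R;
  sp_time0 : forall w, sp_time 0%N w = 0;
  sp_time_stopping : forall i, stopping_time F (sp_time i);
  sp_time_mono : forall i w, sp_time i w <= sp_time i.+1 w;
  sp_init_meas : measurable_wrt (F 0) sp_init;
  sp_coef_meas : forall i,
    measurable_wrt (stopped_sigma F (sp_time i)) (sp_coef i) }.

Definition sp_process (S : simple_predictable) (t : R) (w : T) : R :=
  (if t == 0 then sp_init S w else 0) +
  \sum_(i < sp_size S)
    (if sp_time S i w < t <= sp_time S i.+1 w then sp_coef S i w else 0).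

(* Integral over ]0, t]: the term at time 0 does not contribute. *)
Definition sp_integral (S : simple_predictable) (X : R -> T -> R)
    (t : R) (w : T) : R :=
  \sum_(i < sp_size S)
    sp_coef S i w * (X (Num.min (sp_time S i.+1 w) t) w -
                     X (Num.min (sp_time S i w) t) w).

Definition ucp_cvg (Z : nat -> R -> T -> R) (V : R -> T -> R) : Prop :=
  forall t e : R, 0 <= t -> 0 < e ->
    P [set w | (e%:E <
        ereal_sup [set (`|Z n s w - V s w|)%:E | s in `[0%R, t]])%E]
      @[n --> \oo] --> 0%E.

(* I is the integral process of the adapted caglad process H against the
   semimartingale X: the value at H of the ucp-continuous extension of
   [sp_integral ^~ X]. It is determined up to indistinguishability. *)
Definition is_stochastic_integral (H X I : R -> T -> R) : Prop :=
  [/\ adapted F H /\ caglad H,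
      adapted F I /\ cadlag I,
      exists S : nat -> simple_predictable,
        ucp_cvg (fun n => sp_process (S n)) H &
      forall S : nat -> simple_predictable,
        ucp_cvg (fun n => sp_process (S n)) H ->
        ucp_cvg (fun n => sp_integral (S n) X) I].

(* [X] = X^2 - X_0^2 - 2 \int X_- dX *)
Definition is_quadratic_variation (X Q : R -> T -> R) : Prop :=
  (adapted F Q /\ cadlag Q) /\
  exists2 J : R -> T -> R,
    is_stochastic_integral (left_limit X) X J &
    {ae P, forall w, forall t, 0 <= t ->
       Q t w = X t w ^+ 2 - X 0 w ^+ 2 - 2 * J t w}.

End StochasticIntegral.

(* Main.v *)
(* Normality alone forces the limit. With M = X - X_0, the process M^2 is a
   submartingale and E[M_t^2] = t, so Doob's inequality gives
   P(sup_(s < t) M_s^2 > c) <= t / c. For t = 2^(m+1) and c = (2^m / 2)^2 these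
   bounds are summable, and by Borel-Cantelli almost surely |M_s| <= s / 2 for
   all large s; hence Y_s = X_0 + M_s + s >= X_0 + s / 2. *)

Require Import Defs.
From mathcomp Require Import measurable_realfun ring lra.

Set Implicit Arguments.
Unset Strict Implicit.
Unset Printing Implicit Defensive.

Import Order.TTheory GRing.Theory Num.Theory.
Import numFieldNormedType.Exports.

Local Open Scope classical_set_scope.
Local Open Scope ring_scope.

Lemma sigma_algebraU (T : Type) (G : set (set T)) (A B : set T) :
  sigma_algebra setT G -> G A -> G B -> G (A `|` B).
Proof.
move=> [G0 _ Gcup] GA GB; rewrite -bigcup2E; apply: Gcup.
by case=> [|[|n]].
Qed.

(** * Doob's maximal inequality for a nonnegative submartingale *)

Section MaximalInequality.
Context (R : realType) (d : measure_display) (T : measurableType d)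
  (P : probability T R) (F : R -> set (set T)) (S : R -> T -> R).
Hypotheses (HF : is_filtration F) (S_adapted : adapted F S)
  (S_ge0 : forall (t : R) w, 0 <= t -> 0 <= S t w)
  (S_submg : forall (s t : R) A, 0 <= s -> s <= t -> F s A ->
    (\int[P]_(w in A) (S s w)%:E <= \int[P]_(w in A) (S t w)%:E)%E).

Let measurable_filtration t A : 0 <= t -> F t A -> measurable A.
Proof. by move=> t0; apply: (HF.1 t t0).2. Qed.

Let measurable_S t A : 0 <= t -> measurable_fun A (fun w => (S t w)%:E).
Proof.
move=> t0; apply/measurable_EFinP => mA B mB.
by apply: measurableI => //; exact: measurable_filtration t0 (S_adapted t0 mB).
Qed.

(** A finite union instead of a maximum, so that induction on [n] splits off the last sampling
    time. *)
Definition exceed (c : R) (u : nat -> R) (n : nat) : set T :=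
  \big[setU/set0]_(k < n.+1) [set w | c <= S (u k) w].

Lemma exceed_filtration c u n : 0 <= u 0%N ->
  {homo u : k l / (k <= l)%N >-> k <= l} -> F (u n) (exceed c u n).
Proof.
move=> u0 umono.
have uge0 k : 0 <= u k by apply: le_trans u0 (umono _ _ _).
have FC k : F (u k) [set w | c <= S (u k) w].
  have -> : [set w | c <= S (u k) w] = S (u k) @^-1` `[c, +oo[.
    by apply/seteqP; split=> w /=; rewrite in_itv/= andbT.
  by apply: S_adapted => //; exact: measurable_itv.
elim: n => [|n IH]; rewrite /exceed big_ord_recr /=.
  by rewrite big_ord0 set0U.
apply: sigma_algebraU => //; first exact: (HF.1 _ (uge0 _)).1.
by apply: HF.2 IH => //; exact: umono.
Qed.

(** Induction on [n], splitting the event by whether [c] was already reached before the last time.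
    If so, the event belongs to the earlier sigma-algebra and the submartingale property moves the
    integral forward; if not, [S] is at least [c] at the last time itself. *)
Lemma le_exceed c u n : 0 <= c -> 0 <= u 0%N ->
  {homo u : k l / (k <= l)%N >-> k <= l} ->
  (c%:E * P (exceed c u n) <= \int[P]_(w in exceed c u n) (S (u n) w)%:E)%E.
Proof.
move=> c0 u0 umono.
have uge0 k : 0 <= u k by apply: le_trans u0 (umono _ _ _).
have chebyshev A k : measurable A -> A `<=` [set w | c <= S (u k) w] ->
    (c%:E * P A <= \int[P]_(w in A) (S (u k) w)%:E)%E.
  move=> mA AC; rewrite -integral_cst//; apply: ge0_le_integral => //.
  exact: measurable_S.
have FB k : F (u k) (exceed c u k) by exact: exceed_filtration.
have mB k : measurable (exceed c u k).
  exact: measurable_filtration (uge0 k) (FB k).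
elim: n => [|n IH].
  by apply: chebyshev => //; rewrite /exceed big_ord1.
have -> : exceed c u n.+1 = exceed c u n `|` (exceed c u n.+1 `\` exceed c u n).
  by rewrite setDUK// /exceed [X in _ `<=` X]big_ord_recr/=; exact: subsetUl.
have mD : measurable (exceed c u n.+1 `\` exceed c u n) by exact: measurableD.
have dis : [disjoint exceed c u n & exceed c u n.+1 `\` exceed c u n].
  by apply/disj_setPS; rewrite setDIK.
rewrite measureU//; last by rewrite setDIK.
rewrite ge0_integral_setU//; last 2 first.
- exact: measurable_S.
- by move=> w _; rewrite lee_fin; exact: S_ge0.
rewrite ge0_muleDr//; apply: leeD.
  by apply: le_trans IH _; apply: S_submg => //; exact: umono.
apply: chebyshev => // w []; rewrite {1}/exceed big_ord_recr/= => -[|//].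
by move=> Bw nBw; exfalso; exact: nBw.
Qed.

(** * Passage to continuous time along dyadic subdivisions of $[0, t]$ *)

Definition dyadic (t : R) (n k : nat) : R := t * (k%:R / 2 ^+ n).

Lemma dyadic_ge0 t n k : 0 <= t -> 0 <= dyadic t n k.
Proof. by move=> t0; rewrite mulr_ge0// divr_ge0// exprn_ge0. Qed.

Lemma dyadic_mono t n : 0 <= t ->
  {homo dyadic t n : k l / (k <= l)%N >-> k <= l}.
Proof.
by move=> t0 k l kl; rewrite /dyadic ler_wpM2l// ler_pM2r ?ler_nat.
Qed.

(** A countable, hence measurable, substitute for the event that the supremum of [S] over $[0, t]$
    reaches [c]. *)
Definition dyadic_exceed (c t : R) : set T :=
  \bigcup_n exceed c (dyadic t n) (2 ^ n).

Lemma exceedP c u n w : exceed c u n w <->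
  exists2 k, (k <= n)%N & c <= S (u k) w.
Proof.
rewrite /exceed -(bigcup_mkord n.+1 (fun k => [set w | c <= S (u k) w])).
by split=> [[k /= kn ?]|[k kn ?]]; exists k.
Qed.

Lemma measurable_dyadic_exceed c t : 0 <= t -> measurable (dyadic_exceed c t).
Proof.
move=> t0; apply: bigcup_measurable => n _.
have := @exceed_filtration c (dyadic t n) (2 ^ n).
move=> /(_ (dyadic_ge0 _ _ t0) (dyadic_mono n t0)).
by apply: measurable_filtration; exact: dyadic_ge0.
Qed.

(** The grids are nested, so the events increase with [n] and their probabilities converge; every
    grid ends at [t], so the discrete bound is uniform in [n]. *)
Lemma doob_maximal c t : 0 <= c -> 0 <= t ->
  (c%:E * P (dyadic_exceed c t) <= \int[P]_w (S t w)%:E)%E.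
Proof.
move=> c0 t0.
have FB n : F (dyadic t n (2 ^ n)) (exceed c (dyadic t n) (2 ^ n)).
  by apply: exceed_filtration; [exact: dyadic_ge0|exact: dyadic_mono].
have mB n : measurable (exceed c (dyadic t n) (2 ^ n)).
  by apply: measurable_filtration (FB n); exact: dyadic_ge0.
have cvgB : P (exceed c (dyadic t n) (2 ^ n)) @[n --> \oo] -->
    P (dyadic_exceed c t).
  apply: nondecreasing_cvg_mu => //; first exact: measurable_dyadic_exceed.
  apply/nondecreasing_seqP => n; apply/subsetPset => w.
  move=> /exceedP[k kn cS]; apply/exceedP; exists (2 * k)%N.
    by rewrite expnS leq_mul2l kn orbT.
  (* Each grid point survives in the next grid, with doubled index. *)
  suff -> : dyadic t n.+1 (2 * k) = dyadic t n k by [].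
  rewrite /dyadic natrM exprS invfM mulrACA divff ?mul1r//.
have cvgcB := cvgeZl (isT : c%:E \is a fin_num) cvgB.
rewrite -(cvg_lim _ cvgcB)//; apply: lime_le.
  by apply/cvg_ex; exists (c%:E * P (dyadic_exceed c t))%E.
apply: nearW => n.
apply: (le_trans (le_exceed (2 ^ n) c0 (dyadic_ge0 n 0 t0) (dyadic_mono n t0))).
have -> : dyadic t n (2 ^ n) = t.
  by rewrite /dyadic natrX divff ?mulr1// expf_neq0.
apply: ge0_subset_integral => //; first exact: measurable_S.
by move=> w _; rewrite lee_fin; exact: S_ge0.
Qed.

(** By right continuity a strict excess at [s] persists on some $]s, s + e[$, and a grid of mesh
    below [e] has a point there. *)
Lemma dyadic_exceed_cadlag c s t w : 0 <= s -> s < t ->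
  S r w @[r --> s^'+] --> S s w -> c < S s w -> dyadic_exceed c t w.
Proof.
move=> s0 st Scont cS.
have t0 : 0 < t by exact: le_lt_trans st.
have [e e0 He] : exists2 e, 0 < e & forall r, s < r -> r < s + e -> c < S r w.
  have := cvgr_gt _ Scont c cS.
  move=> [e/= e0 He]; exists e => // r sr rse; apply: He => //=.
  by rewrite distrC ger0_norm ?subr_ge0 ?ltW// ltrBlDl.
have [n tn] : exists n, t / 2 ^+ n < e.
  (* The Archimedean bound satisfies $t / e < n < 2^n$. *)
  exists (Num.bound (t / e)).
  rewrite ltr_pdivrMr ?exprn_gt0// mulrC -ltr_pdivrMr//.
  apply: (@lt_le_trans _ _ (Num.bound (t / e))%:R).
    by apply: archi_boundP; rewrite divr_ge0// ltW.
  by rewrite -natrX ler_nat ltnW// ltn_expl.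
have p0 : 0 < 2 ^+ n :> R by rewrite exprn_gt0.
(* [x] is [s] in units of the mesh. The index [(Num.truncn x).+1] gives the first grid point
   strictly after [s]; it is at most $2^n$ because [s < t]. *)
set x := s / t * 2 ^+ n.
have x0 : 0 <= x by rewrite !mulr_ge0 ?invr_ge0// ltW.
have /andP[kx xk] := truncn_itv x0.
exists n => //; apply/exceedP; exists (Num.truncn x).+1.
  rewrite -(ltr_nat R) (le_lt_trans kx)// natrX gtr_pMl//.
  by rewrite ltr_pdivrMr// mul1r.
have sE : s = t * (x / 2 ^+ n).
  by rewrite /x; field; rewrite !gt_eqF.
apply/ltW/He; rewrite /dyadic.
  by rewrite {1}sE ltr_pM2l// ltr_pM2r ?invr_gt0.
apply: (@le_lt_trans _ _ (s + t / 2 ^+ n)); last by rewrite ltrD2l.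
rewrite {1}sE -mulrDr ler_pM2l// -[X in _ + X]mul1r -mulrDl.
by rewrite ler_pM2r ?invr_gt0// -natr1 lerD2r.
Qed.

End MaximalInequality.

(** * Second moments and linear growth of normal martingales *)

Section NormalMartingale.
Context (R : realType) (d : measure_display) (T : measurableType d)
  (P : probability T R) (F : R -> set (set T)) (X : R -> T -> R).
Hypotheses (HF : is_filtration F) (HX : normal_martingale P F X).

Let S t w := (X t w - X 0 w) ^+ 2.

Lemma normal_sqr_adapted : adapted F S.
Proof.
have [adN _ _ _] := HX.2; move=> t t0 B mB.
have -> : S t @^-1` B =
    (fun w => (X t w - X 0 w) ^+ 2 - t) @^-1` ((fun x => x + t) @^-1` B).
  by apply/seteqP; split=> w /=; rewrite subrK.
apply: adN => //; rewrite -[X in measurable X]setTI.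
have mt : measurable_fun setT (fun x : R => x + t) by apply: measurable_funD.
exact: mt.
Qed.

(** The martingale identity for $S_r - r$, with the compensator added back. It yields both the
    submartingale property of [S] and, for the whole space and [s = 0], its expectation. *)
Lemma integral_normal_sqr s t A : 0 <= s -> s <= t -> F s A ->
  (\int[P]_(w in A) (S t w)%:E =
   \int[P]_(w in A) (S s w)%:E + (t - s)%:E * P A)%E.
Proof.
move=> s0 st FA; have [_ _ intN condN] := HX.2.
have t0 : 0 <= t by exact: le_trans st.
have mA : measurable A by exact: (HF.1 s s0).2.
have SE r : 0 <= r -> (\int[P]_(w in A) (S r w)%:E =
    \int[P]_(w in A) (S r w - r)%:E + r%:E * P A)%E.
  move=> r0; rewrite -integral_cst// -integralD//; last 2 first.
  - by apply: integrableS (intN r r0).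
  - exact: finite_measure_integrable_cst.
  by apply: eq_integral => w _; rewrite -EFinD subrK.
have [_ _ /(_ _ FA) NE] := condN s t s0 st.
rewrite SE// (SE s)// NE -addeA; congr (_ + _)%E.
rewrite -(fineK (fin_num_measure P A mA)) -!EFinM -EFinD; congr EFin; ring.
Qed.

Lemma expectation_normal_sqr t : 0 <= t -> (\int[P]_w (S t w)%:E = t%:E)%E.
Proof.
move=> t0; have [[F0 FC _] _] := HF.1 0 (lexx 0).
have FT : F 0 setT by rewrite -(setD0 setT); exact: FC.
rewrite (integral_normal_sqr (lexx 0) t0 FT) probability_setT mule1 subr0.
by rewrite integral0_eq ?add0e// => w _; rewrite /S subrr expr0n.
Qed.

Lemma normal_maximal c t : 0 < c -> 0 <= t ->
  (P (dyadic_exceed S c t) <= (t / c)%:E)%E.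
Proof.
move=> c0 t0; rewrite EFinM lee_pdivlMr// muleC -[leRHS]expectation_normal_sqr//.
apply: (doob_maximal HF normal_sqr_adapted) => // [s w _|s r A s0 sr FA|].
- exact: sqr_ge0.
- rewrite (integral_normal_sqr s0 sr FA) leeDl// mule_ge0//.
  by rewrite lee_fin subr_ge0.
- exact: ltW.
Qed.

Lemma normal_martingale_drift :
  {ae P, forall w, \forall t \near +oo, t <= 2 * (X t w - X 0 w + t)}.
Proof.
(* The level is the square of half the left end of the block $[2^m, 2^{m+1}[$. *)
pose c m : R := (2 ^+ m / 2) ^+ 2.
pose B m := dyadic_exceed S (c m) (2 ^+ m.+1).
have c0 m : 0 < c m by rewrite exprn_gt0// divr_gt0 ?exprn_gt0.
have mB m : measurable (B m).
  apply: (measurable_dyadic_exceed HF normal_sqr_adapted).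
  by rewrite exprn_ge0.
have PB : P (lim_sup_set B) = 0%E.
  apply: lim_sup_set_cvg0 => //.
  (* Here $2^{m+1} / (2^m / 2)^2 = 16 / 2^{m+1}$, a geometric series with sum 16. *)
  apply: (@le_lt_trans _ _ (\sum_(m <oo) (16 / (2 ^ m.+1)%:R)%:E)%E).
    apply: lee_nneseries => // m _.
    apply: (le_trans (normal_maximal (c0 m) _)); first exact: exprn_ge0.
    rewrite lee_fin /c natrX !exprS le_eqVlt; apply/orP; left; apply/eqP.
    by field; rewrite expf_neq0.
  by apply: le_lt_trans (epsilon_trick0 _ _) _; rewrite ?ltry.
exists (lim_sup_set B); split => //.
  by apply: bigcapT_measurable => n; exact: bigcup_measurable.
(* By contraposition: if [w] avoids [B m] for all [m >= m0], the bound holds at every time beyond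
   $2^{m_0}$. *)
move=> w nw m0 _; apply: contrapT => nB; apply: nw.
exists (2 ^+ m0); split; first exact: num_real.
move=> t mt.
have t0 : 0 <= t by apply: le_trans (ltW mt); rewrite exprn_ge0.
have /andP[kt tk] := truncn_itv t0.
have k0 : (2 ^ m0 <= Num.truncn t)%N.
  by rewrite -ltnS -(ltr_nat R) natrX (lt_trans mt).
(* The block containing [t] is found from the integer part of [t]; its right end is strictly larger
   than [t], as the right-continuity argument requires. *)
have /andP[mk km] := trunc_log_bounds (ltnSn 1)
  (leq_trans (expn_gt0 2 m0) k0).
set m := trunc_log 2 _ in mk km.
have mt' : 2 ^+ m <= t by rewrite (le_trans _ kt)// -natrX ler_nat.
have tm : t < 2 ^+ m.+1.
  by rewrite (lt_le_trans tk)// -natrX ler_nat.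
have m0m : (m0 <= m)%N by exact: trunc_log_max.
have : S t w <= c m.
  rewrite leNgt; apply/negP => cS; apply: nB; exists m => //.
  apply: dyadic_exceed_cadlag cS => //.
  have [_ cX _ _] := HX.1; have [/(_ t0) Xt _] := cX w t.
  have Xt' : X r w - X 0 w @[r --> t^'+] --> X t w - X 0 w.
    by apply: cvgB => //; exact: cvg_cst.
  exact: (cvgM Xt' Xt').
have hm : 0 <= 2 ^+ m / 2 :> R by rewrite divr_ge0// exprn_ge0.
(* Taking square roots gives $X_t - X_0 \ge -2^m / 2 \ge -t / 2$. *)
rewrite /S /c -[X in X <= _]real_normK ?num_real// ler_pXn2r ?nnegrE//.
by rewrite ler_norml => /andP[Mh _]; lra.
Qed.

End NormalMartingale.

Theorem corollary3p5 (R : realType) (d : measure_display)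
  (T : measurableType d) (P : probability T R)
  (F : R -> set (set T))
  (HF : is_filtration F) (HFgen : generates F) (HFusual : usual_conditions P F)
  (X : R -> T -> R)
  (HX : normal_martingale P F X)
  (HX0 : {ae P, forall w, X 0 w = 0})
  (QX : R -> T -> R) (HQX : is_quadratic_variation P F X QX)
  (I : R -> T -> R)
  (HI : is_stochastic_integral P F (fun s w => 1 - s - left_limit X s w) X I)
  (HQI : {ae P, forall w, forall t, 0 <= t -> QX t w = I t w + t})
  (Y : R -> T -> R) (HY : forall t w, 0 <= t -> Y t w = X t w + t) :
  {ae P, forall w, Y t w @[t --> +oo] --> +oo}.
Proof.
apply: filterS (normal_martingale_drift HF HX) => w drift.
apply/cvgryPge => A; near=> t.
have t0 : 0 <= t by near: t; apply: nbhs_pinfty_ge; exact: num_real.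
(* With the drift bound, $2 (A - X_0) \le t \le 2 (Y_t - X_0)$, hence $A \le Y_t$. *)
have : 2 * (A - X 0 w) <= t.
  by near: t; apply: nbhs_pinfty_ge; exact: num_real.
have : t <= 2 * (X t w - X 0 w + t) by near: t.
rewrite HY//; lra.
Unshelve. all: by end_near.
Qed.
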